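(* Let $n\ge 2$ be an integer, let $\rho_{\text{in}}\in\mathbb{C}^{2^n\times 2^n}$ be an $n$-qubit density matrix, and let $\alpha(\rho_{\text{in}})=\text{Tr}[(\sigma_1\otimes I^{\otimes(n-1)})\rho_{\text{in}}]^2+\text{Tr}[(\sigma_3\otimes I^{\otimes(n-1)})\rho_{\text{in}}]^2$. (i) (Tree tensor.) If $n$ is a power of $2$, then the objective function $f_{\text{TT}}$ of the $n$-qubit TT-QNN satisfies $$\frac{1+\log_2 n}{2n}\,\alpha(\rho_{\text{in}})\;\le\;\mathbb{E}_{\boldsymbol{\theta}}\,\|\nabla_{\boldsymbol{\theta}} f_{\text{TT}}\|^2\;\le\;2n-1.$$ (ii) (Step controlled.) For every integer $n_c$ with $1\le n_c\le n-1$, the objective function $f_{\text{SC}}$ of the $n$-qubit SC-QNN with parameter $n_c$ satisfies $$\frac{1+n_c}{2^{1+n_c}}\,\alpha(\rho_{\text{in}})\;\le\;\mathbb{E}_{\boldsymbol{\theta}}\,\|\nabla_{\boldsymbol{\theta}} f_{\text{SC}}\|^2\;\le\;2n-1.$$ In both cases the expectation is over all $2n-1$ circuit parameters drawn independently and uniformly from $[0,2\pi]$, and $\nabla_{\boldsymbol\theta}$ is the gradient with respect to all of them.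
   Context: Pauli matrices: $\sigma_0=I$, $\sigma_1=X=\begin{pmatrix}0&1\\1&0\end{pmatrix}$, $\sigma_2=Y=\begin{pmatrix}0&-i\\i&0\end{pmatrix}$, $\sigma_3=Z=\begin{pmatrix}1&0\\0&-1\end{pmatrix}$. Qubits are numbered $1,\dots,n$. A rotation with parameter $\theta$ on qubit $q$ is the gate $e^{-i\theta\sigma_2}$ acting on qubit $q$ (identity elsewhere). A CNOT with control $c$ and target $t$ is $|0\rangle\langle 0|_c\otimes I_t+|1\rangle\langle1|_c\otimes (\sigma_1)_t$ (identity elsewhere). For a parameterized circuit unitary $V(\boldsymbol\theta)$ the objective is $f(\boldsymbol\theta)=\frac12+\frac12\text{Tr}[(\sigma_3\otimes I^{\otimes(n-1)})V(\boldsymbol\theta)\rho_{\text{in}}V(\boldsymbol\theta)^\dagger]$. TT-QNN ($n=2^m$): $V_{\text{TT}}=V_{m+1}CX_mV_m\cdots CX_1V_1$, where for $\ell=1,\dots,m+1$ the layer $V_\ell$ is the tensor product of independent-parameter rotations $e^{-i\theta_\ell^{(j)}\sigma_2}$ on qubits $(j-1)2^{\ell-1}+1$, $j=1,\dots,n2^{1-\ell}$; and for $\ell=1,\dots,m$ the layer $CX_\ell$ is the product of CNOTs with control qubit $(j-\tfrac12)2^\ell+1$ and target qubit $(j-1)2^\ell+1$, $j=1,\dots,n2^{-\ell}$. It has $2n-1$ parameters; $f_{\text{TT}}$ is $f$ with $V=V_{\text{TT}}$. SC-QNN with parameter $n_c$: $V_{\text{SC}}=V_nCX_{n-1}V_{n-1}\cdots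 CX_1V_1$, where $V_1$ applies an independent-parameter rotation to every qubit; for $2\le\ell\le n-n_c$, $V_\ell$ is a single rotation on qubit $n+1-\ell$; for $n-n_c+1\le \ell\le n$, $V_\ell$ is a single rotation on qubit $1$; for $1\le\ell\le n-1-n_c$, $CX_\ell$ is a CNOT with control qubit $n+1-\ell$ and target qubit $n-\ell$; for $n-n_c\le\ell\le n-1$, $CX_\ell$ is a CNOT with control qubit $n+1-\ell$ and target qubit $1$. Thus $n_c$ is the number of CNOTs targeting qubit 1 directly, and there are $2n-1$ parameters; $f_{\text{SC}}$ is $f$ with $V=V_{\text{SC}}$. *)

(* Defs.v *)
From HB Require Import structures.
From mathcomp Require Import all_boot all_order all_algebra.
From mathcomp Require Import complex.
From mathcomp Require Import all_classical all_reals all_analysis.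

Unset Implicit Arguments.
Unset Strict Implicit.
Unset Printing Implicit Defensive.
Import Order.TTheory GRing.Theory Num.Theory.
Import numFieldNormedType.Exports.
Local Open Scope ring_scope.

(* Computational basis of n qubits: indices i : 'I_(2^n).  Qubits are       *)
(* numbered 1..n, qubit 1 being the FIRST (leftmost, most significant)      *)
(* tensor factor, so that sigma_3 (x) I^(n-1) acts on qubit 1.              *)

Section Qubits.
Variable (R : realType).
Local Notation C := R[i].

Definition qbit (n q i : nat) : bool := odd (i %/ 2 ^ (n - q)).

Definition agree_except (n q : nat) (i j : 'I_(2 ^ n)) : bool :=
  [forall p : 'I_n, (p.+1 != q) ==> (qbit n p.+1 i == qbit n p.+1 j)].

(* 2x2 entries (row b, column b') of the single-qubit gate
   e^{-i t sigma_2} = cos t I - i sin t sigma_2 = [[cos t, - sin t],[sin t, cos t]] *)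
Definition rotY_entry (t : R) (b b' : bool) : R :=
  match b, b' with
  | false, false => cos t
  | false, true => - sin t
  | true, false => sin t
  | true, true => cos t
  end.

Definition rot_mx (n q : nat) (t : R) : 'M[C]_(2 ^ n) :=
  \matrix_(i, j) if agree_except n q i j
                 then real_complex R (rotY_entry t (qbit n q i) (qbit n q j)) else 0.

(* CNOT with control c, target t :
   |0><0|_c (x) I_t + |1><1|_c (x) (sigma_1)_t, identity elsewhere *)
Definition cnot_mx (n c t : nat) : 'M[C]_(2 ^ n) :=
  \matrix_(i, j) if agree_except n t i j &&
                    (qbit n t i == qbit n t j (+) qbit n c j) then 1 else 0.

Definition Z1_mx (n : nat) : 'M[C]_(2 ^ n) :=
  \matrix_(i, j) if i == j then (if qbit n 1 i then -1 else 1) else 0.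
Definition X1_mx (n : nat) : 'M[C]_(2 ^ n) :=
  \matrix_(i, j) if agree_except n 1 i j && (qbit n 1 i != qbit n 1 j)
                 then 1 else 0.

Definition adj_mx {m : nat} (A : 'M[C]_m) : 'M[C]_m := map_mx conjc A^T.

Definition density_matrix {m : nat} (rho : 'M[C]_m) : Prop :=
  [/\ adj_mx rho = rho,
      (forall v : 'cV[C]_m, 0 <= ((map_mx conjc v)^T *m rho *m v) 0 0)
    & \tr rho = 1].

(* alpha(rho) = Tr[(sigma_1 (x) I) rho]^2 + Tr[(sigma_3 (x) I) rho]^2
   (both traces are real since rho is Hermitian) *)
Definition alpha {n : nat} (rho : 'M[C]_(2 ^ n)) : R :=
  (complex.Re (\tr (X1_mx n *m rho))) ^+ 2 + (complex.Re (\tr (Z1_mx n *m rho))) ^+ 2.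

(* Circuits: a list of gates in order of application.  The k-th rotation    *)
(* (k = 0, 1, ...) in the list carries the independent parameter theta k.   *)
Inductive gate := RotG of nat (* qubit *) | CXG of nat (* control *) & nat (* target *).

Fixpoint circ_aux (n : nat) (theta : nat -> R) (k : nat) (s : seq gate)
    (acc : 'M[C]_(2 ^ n)) : 'M[C]_(2 ^ n) :=
  match s with
  | [::] => acc
  | RotG q :: s' => circ_aux n theta k.+1 s' (rot_mx n q (theta k) *m acc)
  | CXG c t :: s' => circ_aux n theta k s' (cnot_mx n c t *m acc)
  end.

Definition circuit_mx (n : nat) (s : seq gate) (theta : nat -> R) : 'M[C]_(2 ^ n) :=
  circ_aux n theta 0 s 1%:M.

Definition nparams (s : seq gate) : nat :=
  count (fun g => if g is RotG _ then true else false) s.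

(* objective f(theta) = 1/2 + 1/2 Tr[(sigma_3 (x) I) V rho V^dagger]
   (real since rho is Hermitian; we take the real part) *)
Definition objective (n : nat) (s : seq gate) (rho : 'M[C]_(2 ^ n))
    (theta : nat -> R) : R :=
  2^-1 + 2^-1 * complex.Re (\tr (Z1_mx n *m circuit_mx n s theta *m rho
                           *m adj_mx (circuit_mx n s theta))).

Definition upd (theta : nat -> R) (k : nat) (t : R) : nat -> R :=
  fun i => if i == k then t else theta i.

Definition partial (f : (nat -> R) -> R) (k : nat) (theta : nat -> R) : R :=
  derive1 (fun t => f (upd theta k t)) (theta k).

Definition grad_sqnorm (P : nat) (f : (nat -> R) -> R) (theta : nat -> R) : R :=
  \sum_(k < P) (partial f k theta) ^+ 2.

(* expectation with theta_0, ..., theta_(P-1) i.i.d. uniform on [0, 2 pi]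
   (iterated normalized Lebesgue integrals) *)
Fixpoint expect (P : nat) (g : (nat -> R) -> R) : R :=
  match P with
  | 0 => g (fun _ => 0)
  | P'.+1 => expect P' (fun theta =>
        (2 * pi)^-1 * \int[lebesgue_measure]_(t in `[0, 2 * pi]%classic)
                           g (upd theta P' t))
  end.

(* layer V_l: rotations on qubits (j-1) 2^(l-1) + 1, j = 1..n 2^(1-l) *)
Definition tt_rot_layer (n l : nat) : seq gate :=
  [seq RotG (j * 2 ^ l.-1 + 1) | j <- iota 0 (n %/ 2 ^ l.-1)].
(* layer CX_l: CNOT control (j-1/2) 2^l + 1, target (j-1) 2^l + 1, j = 1..n 2^-l *)
Definition tt_cx_layer (n l : nat) : seq gate :=
  [seq CXG (j * 2 ^ l + 2 ^ l.-1 + 1) (j * 2 ^ l + 1) | j <- iota 0 (n %/ 2 ^ l)].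
(* V_TT = V_(m+1) CX_m V_m ... CX_1 V_1, n = 2^m *)
Definition tt_circuit (m : nat) : seq gate :=
  flatten [seq tt_rot_layer (2 ^ m) l ++ tt_cx_layer (2 ^ m) l | l <- iota 1 m]
  ++ tt_rot_layer (2 ^ m) m.+1.

(* V_SC = V_n CX_(n-1) V_(n-1) ... CX_1 V_1 *)
Definition sc_circuit (n nc : nat) : seq gate :=
  [seq RotG q | q <- iota 1 n] ++
  flatten [seq [:: CXG (n + 1 - l)%N (if (l <= n - 1 - nc)%N then (n - l)%N else 1%N);
                   RotG (if (l.+1 <= n - nc)%N then (n + 1 - l.+1)%N else 1%N)]
          | l <- iota 1 (n - 1)].

End Qubits.

(* Main.v *)
Require Import Defs.
From HB Require Import structures.
From mathcomp Require Import all_boot all_order all_algebra.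
From mathcomp Require Import complex ring lra zify.
From mathcomp Require Import all_classical all_reals all_analysis.
Import Order.TTheory GRing.Theory Num.Theory.
Import numFieldNormedType.Exports.
Local Open Scope ring_scope.

(* Write x and z for the expectations of sigma_1 and sigma_3 on qubit 1
   along the circuit. A rotation of qubit 1 by t turns (x, z) by the angle 2 t,
   so averaging over t sends x^2, and likewise z^2, to (x^2 + z^2) / 2; every
   other gate preserves x, because qubit 1 is never a control. The first and the
   last gate are rotations of qubit 1, hence averaging from the last parameter
   to the first gives E z^2 >= alpha / 2^K, with K the number of rotations of
   qubit 1. Differentiating in one of these K parameters turns one pair (x, z)
   by a further right angle and doubles it, so each of them contributes at least
   alpha / 2^K to the expected squared norm of the gradient. The upper bound
   follows from the parameter-shift rule d f = f(. + pi/4) - f(. - pi/4) and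
   from 0 <= f <= 1. *)

(** * Bits and gates *)

Lemma eq_from_bits (n i j : nat) : (i < 2 ^ n)%N -> (j < 2 ^ n)%N ->
  (forall k, (k < n)%N -> odd (i %/ 2 ^ k) = odd (j %/ 2 ^ k)) -> i = j.
Proof.
elim: n i j => [|n IHn] i j; first by rewrite expn0; lia.
rewrite expnS => lti ltj eqb.
have /= := eqb 0%N isT; rewrite expn0 !divn1 => odd_ij.
rewrite -(odd_double_half i) -(odd_double_half j) odd_ij; congr (_ + _.*2)%N.
apply: IHn; [lia | lia | move=> k ltk].
by have := eqb k.+1 ltk; rewrite expnS !divnMA !divn2.
Qed.

Lemma qbit_inj (n : nat) (i j : 'I_(2 ^ n)) :
  (forall p, (1 <= p <= n)%N -> qbit n p i = qbit n p j) -> i = j.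
Proof.
move=> eqb; apply/val_inj/(@eq_from_bits n);
  [exact: ltn_ord | exact: ltn_ord | move=> k ltk].
by have := eqb (n - k)%N; rewrite /qbit subKn; [apply; lia | lia].
Qed.

(** The index is specified by its bits, so that later proofs compare bits and never do arithmetic;
    the default [i] is never reached, as [qbit_flip] shows. *)
Definition flip (n q : nat) (i : 'I_(2 ^ n)) : 'I_(2 ^ n) :=
  odflt i [pick j : 'I_(2 ^ n) | [forall p : 'I_n,
    qbit n p.+1 j == qbit n p.+1 i (+) (p.+1 == q)]].

(** Reading off the bits is an injection of the [2 ^ n] indices into the [2 ^ n] bit strings, hence
    a bijection, so every prescribed bit string is attained and the search succeeds. *)
Lemma qbit_flip (n q p : nat) (i : 'I_(2 ^ n)) : (1 <= p <= n)%N ->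
  qbit n p (flip n q i) = qbit n p i (+) (p == q).
Proof.
pose bits (j : 'I_(2 ^ n)) := [ffun k : 'I_n => qbit n k.+1 j].
have bits_bij : bijective bits.
  apply: inj_card_bij; last by rewrite card_ffun card_bool !card_ord.
  move=> j k /ffunP eqb; apply: qbit_inj => r /andP[r_gt0 r_le].
  have rP : (r.-1 < n)%N by lia.
  by have := eqb (Ordinal rP); rewrite !ffunE /= prednK.
have [g gK bitsK] := bits_bij.
move=> /andP[p_gt0 p_le]; rewrite /flip; case: pickP => [j /forallP eqb|].
  have pP : (p.-1 < n)%N by lia.
  by have /eqP := eqb (Ordinal pP); rewrite /= prednK.
move/(_ (g [ffun k : 'I_n => qbit n k.+1 i (+) (k.+1 == q)])) => /negP[].
by apply/forallP => k; have /ffunP/(_ k) := bitsK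
  [ffun k : 'I_n => qbit n k.+1 i (+) (k.+1 == q)]; rewrite !ffunE => ->.
Qed.

Lemma flipK (n q : nat) : involutive (flip n q).
Proof. by move=> i; apply: qbit_inj => p pn; rewrite !qbit_flip // addbK. Qed.

Lemma flipC (n q r : nat) (i : 'I_(2 ^ n)) :
  flip n q (flip n r i) = flip n r (flip n q i).
Proof. by apply: qbit_inj => p pn; rewrite !qbit_flip // addbAC. Qed.

Lemma flip_neq (n q : nat) (i : 'I_(2 ^ n)) : (1 <= q <= n)%N ->
  (flip n q i == i) = false.
Proof.
move=> qn; apply/negP => /eqP eqf; have := qbit_flip n q q i qn.
by rewrite eqf eqxx; case: qbit.
Qed.

(** Bits determine the index, so only bit [q] is left free; a row of a one-qubit gate thus has at
    most two nonzero entries. *)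
Lemma agree_exceptE (n q : nat) (i j : 'I_(2 ^ n)) : (1 <= q <= n)%N ->
  agree_except n q i j = (j == i) || (j == flip n q i).
Proof.
move=> qn; apply/forallP/orP => [agr|[]/eqP-> p]; last 2 first.
- by rewrite eqxx implybT.
- by apply/implyP => /negPf pq; rewrite qbit_flip ?pq ?addbF //=.
have agr' p : (1 <= p <= n)%N -> p != q -> qbit n p i = qbit n p j.
  move=> /andP[p_gt0 p_le] pq; have pP : (p.-1 < n)%N by lia.
  by have /implyP/= := agr (Ordinal pP); rewrite prednK // => /(_ pq)/eqP.
case: (boolP (qbit n q j == qbit n q i)) => [/eqP eqq|neq].
  by left; apply/eqP/qbit_inj => p pn; case: (eqVneq p q) => [->//|/agr'->].
right; apply/eqP/qbit_inj => p pn; rewrite qbit_flip //.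
case: (eqVneq p q) => [->|pq]; last by rewrite addbF agr'.
by move: neq; do 2 case: qbit.
Qed.

(** Applied with [J] antisymmetric, where the left factor is the adjoint of the right one. *)
Lemma conj_expand (T : comNzRingType) (m : nat) (a b : T) (O J : 'M[T]_m) :
  (a *: 1%:M + b *: - J) *m O *m (a *: 1%:M + b *: J) =
  a ^+ 2 *: O - b ^+ 2 *: (J *m O *m J) + (a * b) *: (O *m J - J *m O).
Proof.
rewrite scalerN mulmxBl mulmxBl !mulmxDr -!(scalemxAl, scalemxAr) !mul1mx !mulmx1.
move: (J *m O *m J) (O *m J) (J *m O) => A B D.
apply/matrixP => i j; rewrite !mxE.
by move: (O i j) (A i j) (B i j) (D i j) => x y z w; ring.
Qed.

Section Gates.
Variables (R : realType) (n : nat).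
Local Notation C := R[i].
Local Notation M := 'M[C]_(2 ^ n).

(** Sign of the entry of - i sigma_2 in row [b]; it is minus the eigenvalue of sigma_3 on that
    bit. *)
Definition sgnb (b : bool) : C := if b then 1 else -1.

Lemma sgnbN b : sgnb (~~ b) = - sgnb b.
Proof. by case: b; rewrite /sgnb /= ?opprK. Qed.

Lemma sgnb_sqr b : sgnb b * sgnb b = 1.
Proof. by case: b; rewrite /sgnb /= ?mulrNN mulr1. Qed.

Lemma eq_flip (q : nat) (i j : 'I_(2 ^ n)) :
  (j == flip n q i) = (i == flip n q j).
Proof. by apply/eqP/eqP => ->; rewrite flipK. Qed.

(* [Jmx q] is [- i sigma_2] on qubit [q]. *)
Definition Jmx (q : nat) : M :=
  \matrix_(i, j) if j == flip n q i then sgnb (qbit n q i) else 0.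

(** The Pauli observables, [Jmx] and the CNOT all have one nonzero entry per row, so every product
    of gates below reduces to this row substitution. *)
Lemma mulmx_pick (f : 'I_(2 ^ n) -> 'I_(2 ^ n)) (c : 'I_(2 ^ n) -> C) (A : M) :
  (\matrix_(i, j) if j == f i then c i else 0) *m A =
  \matrix_(i, k) (c i * A (f i) k).
Proof.
apply/matrixP => i k; rewrite !mxE (bigD1 (f i)) //= mxE eqxx big1 ?addr0 //.
by move=> j /negPf jf; rewrite mxE jf mul0r.
Qed.

Lemma X1_mxE : (0 < n)%N ->
  X1_mx R n = \matrix_(i, j) if j == flip n 1 i then 1 else 0.
Proof.
move=> n0; apply/matrixP => i j; rewrite !mxE agree_exceptE //.
case: (eqVneq j i) => [->|ji] /=; first by rewrite eqxx eq_sym flip_neq.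
case: eqP => //= ->; rewrite qbit_flip // eqxx.
by case: qbit.
Qed.

Lemma Z1_mxE :
  Z1_mx R n = \matrix_(i, j) if j == i then - sgnb (qbit n 1 i) else 0.
Proof.
apply/matrixP => i j; rewrite !mxE eq_sym.
by case: eqP => // _; rewrite /sgnb; case: qbit; rewrite ?opprK.
Qed.

Lemma cnot_mxE (c t : nat) :
  (1 <= c <= n)%N -> (1 <= t <= n)%N -> c != t -> cnot_mx R n c t =
  \matrix_(i, j) if j == (if qbit n c i then flip n t i else i) then 1 else 0.
Proof.
move=> cn tn ct; apply/matrixP => i j; rewrite !mxE agree_exceptE //.
case: (eqVneq j i) => [->|ji] /=.
  case ci: (qbit n c i); first by rewrite [i == _]eq_sym flip_neq //; case: qbit.
  by rewrite addbF !eqxx.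
case: (eqVneq j (flip n t i)) => [->|jf] /=.
  rewrite !qbit_flip // eqxx (negPf ct) addbF.
  by case: (qbit n c i) (qbit n t i) => [] []; rewrite ?eqxx ?flip_neq.
by case: (qbit n c i); rewrite ?(negPf ji) ?(negPf jf).
Qed.

(** The gate is the exponential of [t] times [Jmx q], whose square is - 1. *)
Lemma rot_mxE (q : nat) (t : R) : (1 <= q <= n)%N ->
  rot_mx R n q t = (cos t)%:C%C *: 1%:M + (sin t)%:C%C *: Jmx q.
Proof.
move=> qn; apply/matrixP => i j; rewrite !mxE agree_exceptE //.
case: (eqVneq j i) => [->|ji] /=.
  by rewrite eq_sym flip_neq // mulr0 addr0 mulr1; case: qbit.
rewrite mulr0 add0r; case: eqP => [->|]; last by rewrite mulr0.
rewrite qbit_flip // eqxx /sgnb; case: qbit; rewrite /= ?mulr1 //.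
by rewrite mulrN1 -[RHS]rmorphN.
Qed.

Lemma J_sqr q : (1 <= q <= n)%N -> Jmx q *m Jmx q = - 1%:M.
Proof.
move=> qn; rewrite mulmx_pick; apply/matrixP => i j.
rewrite !mxE flipK qbit_flip // eqxx addbT sgnbN eq_sym.
by case: eqP; rewrite ?mulr0 ?oppr0 // mulrN sgnb_sqr.
Qed.

Lemma X1_comm_J q : (0 < n)%N -> q != 1%N -> (1 <= q <= n)%N ->
  X1_mx R n *m Jmx q = Jmx q *m X1_mx R n.
Proof.
move=> n0 q1 qn; rewrite X1_mxE // !mulmx_pick; apply/matrixP => i j.
rewrite !mxE mul1r flipC qbit_flip // (negPf q1) addbF.
by case: eqP; rewrite ?mulr1 ?mulr0.
Qed.

Lemma mulX1J : (0 < n)%N -> X1_mx R n *m Jmx 1 = Z1_mx R n.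
Proof.
move=> n0; rewrite X1_mxE // mulmx_pick Z1_mxE; apply/matrixP => i j.
by rewrite !mxE mul1r flipK qbit_flip // eqxx addbT sgnbN.
Qed.

Lemma mulJX1 : (0 < n)%N -> Jmx 1 *m X1_mx R n = - Z1_mx R n.
Proof.
move=> n0; rewrite X1_mxE // mulmx_pick Z1_mxE; apply/matrixP => i j.
rewrite !mxE flipK.
by case: eqP; rewrite ?mulr1 ?mulr0 ?opprK ?oppr0.
Qed.

Lemma mulZ1J : (0 < n)%N -> Z1_mx R n *m Jmx 1 = - X1_mx R n.
Proof.
move=> n0; rewrite X1_mxE // Z1_mxE mulmx_pick; apply/matrixP => i j.
rewrite !mxE.
by case: eqP; rewrite ?mulr0 ?oppr0 // mulNr sgnb_sqr.
Qed.

Lemma mulJZ1 : (0 < n)%N -> Jmx 1 *m Z1_mx R n = X1_mx R n.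
Proof.
move=> n0; rewrite X1_mxE // Z1_mxE mulmx_pick; apply/matrixP => i j.
rewrite !mxE qbit_flip // eqxx addbT sgnbN opprK.
by case: eqP; rewrite ?mulr0 // sgnb_sqr.
Qed.

Lemma cnot_sqr c t : (1 <= c <= n)%N -> (1 <= t <= n)%N -> c != t ->
  cnot_mx R n c t *m cnot_mx R n c t = 1%:M.
Proof.
move=> cn tn ct; rewrite cnot_mxE // mulmx_pick; apply/matrixP => i j.
rewrite !mxE mul1r eq_sym.
case ci: (qbit n c i); last by rewrite ci; case: eqP.
by rewrite qbit_flip // (negPf ct) addbF ci flipK; case: eqP.
Qed.

(** The control bit is untouched by sigma_1 on qubit 1, and flips commute; this includes the case
    where the target is qubit 1. *)
Lemma X1_comm_cnot c t : (0 < n)%N -> c != 1%N ->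
  (1 <= c <= n)%N -> (1 <= t <= n)%N -> c != t ->
  X1_mx R n *m cnot_mx R n c t = cnot_mx R n c t *m X1_mx R n.
Proof.
move=> n0 c1 cn tn ct; rewrite X1_mxE // cnot_mxE // !mulmx_pick.
apply/matrixP => i j; rewrite !mxE !mul1r qbit_flip // (negPf c1) addbF.
by case: (qbit n c i); rewrite // flipC.
Qed.

(** * Adjoints, and conjugation of observables by gates *)

Lemma adj_mxM (A B : M) : adj_mx R (A *m B) = adj_mx R B *m adj_mx R A.
Proof. by rewrite /adj_mx trmx_mul map_mxM. Qed.

Lemma adj_mxD (A B : M) : adj_mx R (A + B) = adj_mx R A + adj_mx R B.
Proof. by rewrite /adj_mx linearD map_mxD. Qed.

Lemma adj_mxZ (a : R) (A : M) : adj_mx R (a%:C%C *: A) = a%:C%C *: adj_mx R A.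
Proof.
apply/matrixP => i j; rewrite !mxE rmorphM; congr (_ * _); exact: conjc_real.
Qed.

Lemma adj_mx1 : adj_mx R 1%:M = 1%:M :> M.
Proof. by rewrite /adj_mx trmx1 map_mx1. Qed.

Lemma adj_cnot c t : (1 <= c <= n)%N -> (1 <= t <= n)%N -> c != t ->
  adj_mx R (cnot_mx R n c t) = cnot_mx R n c t.
Proof.
move=> cn tn ct; rewrite cnot_mxE //; apply/matrixP => i j; rewrite !mxE.
have -> : (i == (if qbit n c j then flip n t j else j)) =
          (j == (if qbit n c i then flip n t i else i)).
  have piK : involutive (fun k : 'I_(2 ^ n) => if qbit n c k then flip n t k else k).
    move=> k /=; case ck: (qbit n c k); last by rewrite ck.
    by rewrite qbit_flip // (negPf ct) addbF ck flipK.
  by apply/eqP/eqP => ->; rewrite piK.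
by case: ifP; rewrite (rmorph1, rmorph0).
Qed.

Lemma adj_J q : (1 <= q <= n)%N -> adj_mx R (Jmx q) = - Jmx q.
Proof.
move=> qn; apply/matrixP => i j; rewrite !mxE eq_flip.
case: eqP => [->|]; last by rewrite oppr0 rmorph0.
rewrite qbit_flip // eqxx addbT sgnbN rmorphN /=; congr (- _).
by rewrite /sgnb; case: qbit; rewrite ?rmorphN rmorph1.
Qed.

Lemma rot_conj q t (O : M) : (1 <= q <= n)%N ->
  adj_mx R (rot_mx R n q t) *m O *m rot_mx R n q t =
  (cos t ^+ 2)%:C%C *: O - (sin t ^+ 2)%:C%C *: (Jmx q *m O *m Jmx q) +
  (cos t * sin t)%:C%C *: (O *m Jmx q - Jmx q *m O).
Proof.
move=> qn; rewrite rot_mxE // adj_mxD !adj_mxZ adj_mx1 adj_J //.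
by rewrite conj_expand -!rmorphXn -rmorphM.
Qed.

Lemma rot_unitary q t : (1 <= q <= n)%N ->
  adj_mx R (rot_mx R n q t) *m rot_mx R n q t = 1%:M.
Proof.
(* Unitarity is the conjugation formula for the observable 1, where the commutator vanishes. *)
move=> qn; rewrite -[adj_mx _ _]mulmx1 (rot_conj _ _ _ qn) !mulmx1 mul1mx.
rewrite (J_sqr _ qn).
rewrite (subrr (Jmx q)) scaler0 addr0 scalerN opprK -scalerDl -rmorphD /=.
by rewrite cos2Dsin2 rmorph1 scale1r.
Qed.

Lemma rot_conj_X1 q t : (0 < n)%N -> q != 1%N -> (1 <= q <= n)%N ->
  adj_mx R (rot_mx R n q t) *m X1_mx R n *m rot_mx R n q t = X1_mx R n.
Proof.
move=> n0 q1 qn; rewrite (rot_conj _ _ _ qn) -(X1_comm_J _ n0 q1 qn) -mulmxA.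
rewrite (J_sqr _ qn) (subrr (X1_mx R n *m Jmx q)).
rewrite scaler0 addr0 mulmxN mulmx1 scalerN opprK -scalerDl -rmorphD /=.
by rewrite cos2Dsin2 rmorph1 scale1r.
Qed.

(** [Jmx 1] anticommutes with both observables and exchanges them up to sign, so conjugation rotates
    their span by the doubled angle. *)
Lemma rot1_conj_X1 t : (0 < n)%N ->
  adj_mx R (rot_mx R n 1 t) *m X1_mx R n *m rot_mx R n 1 t =
  (cos (t + t))%:C%C *: X1_mx R n + (sin (t + t))%:C%C *: Z1_mx R n.
Proof.
move=> n0; rewrite (rot_conj 1 _ _ n0) -mulmxA (mulX1J n0) (mulJX1 n0).
rewrite (mulJZ1 n0) opprK -scalerBl -rmorphB -mulr2n -scaler_nat scalerA.
rewrite -(rmorph_nat (real_complex R)) -rmorphM cosD sinD -!expr2 mulrC.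
by rewrite mulr_natl [sin t * _]mulrC -mulr2n.
Qed.

Lemma rot1_conj_Z1 t : (0 < n)%N ->
  adj_mx R (rot_mx R n 1 t) *m Z1_mx R n *m rot_mx R n 1 t =
  (cos (t + t))%:C%C *: Z1_mx R n - (sin (t + t))%:C%C *: X1_mx R n.
Proof.
move=> n0; rewrite (rot_conj 1 _ _ n0) -mulmxA (mulZ1J n0) (mulJZ1 n0).
rewrite mulmxN (mulJX1 n0) opprK -opprD scalerN -scalerBl -rmorphB -mulr2n.
rewrite -scaler_nat scalerA -(rmorph_nat (real_complex R)) -rmorphM cosD sinD.
by rewrite -!expr2 [_ * 2%:R]mulrC mulr_natl [sin t * _]mulrC -mulr2n.
Qed.

Lemma cnot_unitary c t : (1 <= c <= n)%N -> (1 <= t <= n)%N -> c != t ->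
  adj_mx R (cnot_mx R n c t) *m cnot_mx R n c t = 1%:M.
Proof. by move=> cn tn ct; rewrite adj_cnot // cnot_sqr. Qed.

Lemma cnot_conj_X1 c t : (0 < n)%N -> c != 1%N ->
  (1 <= c <= n)%N -> (1 <= t <= n)%N -> c != t ->
  adj_mx R (cnot_mx R n c t) *m X1_mx R n *m cnot_mx R n c t = X1_mx R n.
Proof.
move=> n0 c1 cn tn ct; rewrite -mulmxA (X1_comm_cnot _ _ n0 c1 cn tn ct) mulmxA.
by rewrite (cnot_unitary _ _ cn tn ct) mul1mx.
Qed.

End Gates.

(** * Averages over the parameters *)

Section Averages.
Variable R : realType.
Implicit Types (f g : R -> R) (t : R).

(** The innermost operation of [expect], so that [expectS] holds by computation. *)
Definition avg f : R :=
  (2 * pi)^-1 * \int[lebesgue_measure]_(t in `[0, 2 * pi]%classic) f t.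

Lemma two_pi_gt0 : 0 < 2 * pi :> R.
Proof. by rewrite mulr_gt0 // pi_gt0. Qed.

Lemma continuous_integrable f : continuous f ->
  (@lebesgue_measure R).-integrable `[0, 2 * pi]%classic (EFin \o f).
Proof.
move=> cf; apply: continuous_compact_integrable; first exact: segment_compact.
exact: continuous_subspaceT.
Qed.

Lemma avgD f g : continuous f -> continuous g ->
  avg (fun t => f t + g t) = avg f + avg g.
Proof.
move=> cf cg; rewrite /avg -mulrDr; congr (_ * _).
by rewrite RintegralD //; exact: continuous_integrable.
Qed.

Lemma avgZ c f : continuous f -> avg (fun t => c * f t) = c * avg f.
Proof.
move=> cf; rewrite /avg mulrCA; congr (_ * _).
by rewrite RintegralZl //; exact: continuous_integrable.
Qed.

Lemma avg_ge0 f : (forall t, 0 <= f t) -> 0 <= avg f.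
Proof.
move=> f0; rewrite mulr_ge0 ?invr_ge0 ?(ltW two_pi_gt0) //.
exact: Rintegral_ge0.
Qed.

Lemma avg_cst (c : R) : avg (fun=> c) = c.
Proof.
rewrite /avg Rintegral_cst //.
have /= := @lebesgue_measure_itv R `[0, 2 * pi].
rewrite lte_fin two_pi_gt0 -EFinD subr0 => ->.
by rewrite /= mulrCA mulVf ?mulr1 // gt_eqF // two_pi_gt0.
Qed.

(** * Trigonometric functions of the doubled angle *)

Lemma cos_dbl t : cos (t + t) = cos t ^+ 2 - sin t ^+ 2.
Proof. by rewrite cosD !expr2. Qed.

Lemma sin_dbl t : sin (t + t) = 2 * (cos t * sin t).
Proof. by rewrite sinD; ring. Qed.

Lemma half_angles (A B D t : R) :
  cos t ^+ 2 * A + sin t ^+ 2 * B + cos t * sin t * D =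
  (A + B) / 2 + (A - B) / 2 * cos (t + t) + D / 2 * sin (t + t).
Proof.
rewrite cos_dbl sin_dbl.
(* The constant term is made homogeneous of degree two in the cosine and sine, so that a polynomial
   identity remains. *)
have -> : (A + B) / 2 = (A + B) / 2 * (cos t ^+ 2 + sin t ^+ 2).
  by rewrite cos2Dsin2 mulr1.
by move: (cos t) (sin t) => x y; field.
Qed.

(** Expectations depend on the doubled angle, so a shift by a quarter of pi acts as a right
    angle. *)
Lemma dbl_shift_quarter_pi t : (t + pi / 4) + (t + pi / 4) = (t + t) + pi / 2.
Proof. by move: (@pi R) => p; field. Qed.

Lemma dbl_shift_quarter_piN t : (t - pi / 4) + (t - pi / 4) = (t + t) - pi / 2.
Proof. by move: (@pi R) => p; field. Qed.

Lemma cosBpihalf t : cos (t - pi / 2) = sin t.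
Proof. by rewrite -[in RHS](subrK (pi / 2) t) sinDpihalf. Qed.

Lemma sinBpihalf t : sin (t - pi / 2) = - cos t.
Proof. by rewrite -[in RHS](subrK (pi / 2) t) cosDpihalf opprK. Qed.

Lemma cos_two_pi : cos (2 * pi) = 1 :> R.
Proof. by rewrite mulr_natl cos2pi. Qed.

Lemma sin_two_pi : sin (2 * pi) = 0 :> R.
Proof. by rewrite mulr_natl sin2pi. Qed.

Lemma continuous_trig2 (a b : R) :
  continuous (fun t : R => a * cos (t + t) + b * sin (t + t)).
Proof.
move=> t; apply: cvgD; (apply: cvgM; first exact: cvg_cst).
  apply: continuous_comp; [exact: cvgD|exact: continuous_cos].
apply: continuous_comp; [exact: cvgD|exact: continuous_sin].
Qed.

Lemma continuous_sqr f : continuous f -> continuous (fun t => f t ^+ 2).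
Proof.
move=> cf t; apply: (@continuous_comp _ _ _ f (fun x => x ^+ 2)); first exact: cf.
exact: exprn_continuous.
Qed.

Lemma avg_sqr_trig2 (a b : R) :
  avg (fun t => (a * cos (t + t) + b * sin (t + t)) ^+ 2) =
  (a ^+ 2 + b ^+ 2) / 2.
Proof.
(* The square is (a^2 + b^2) / 2 + (a^2 - b^2) / 2 cos 4t + a b sin 4t; [F] is its primitive, up to
   a constant, with sin 4t and cos 4t expanded in products of [sin t] and [cos t]. *)
pose F t := (a ^+ 2 + b ^+ 2) / 2 * t
  + (a ^+ 2 - b ^+ 2) / 2 * (sin t * cos t * (cos t * cos t - sin t * sin t))
  + 2 * a * b * (sin t * sin t * (cos t * cos t)).
have dF t : is_derive t 1 F ((a * cos (t + t) + b * sin (t + t)) ^+ 2).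
  rewrite /F; apply: is_derive_eq.
  rewrite cos_dbl sin_dbl /GRing.scale /=.
  have := cos2Dsin2 t; set c := cos t; set s := sin t.
  move=> cs; apply/eqP; rewrite -subr_eq0; apply/eqP.
  transitivity ((a ^+ 2 + b ^+ 2) / 2 * (1 - (c ^+ 2 + s ^+ 2) ^+ 2)).
    by field.
  by rewrite cs expr1n subrr mulr0.
have cf : continuous (fun t : R => (a * cos (t + t) + b * sin (t + t)) ^+ 2).
  exact: continuous_sqr (continuous_trig2 a b).
rewrite /avg /Rintegral (@continuous_FTC2 _ _ F) ?two_pi_gt0 //.
- rewrite /F cos_two_pi sin_two_pi cos0 sin0 /= !(mul0r, mulr0, subr0, addr0).
  by rewrite mulrCA mulVf ?mulr1 // gt_eqF // two_pi_gt0.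
- exact: continuous_subspaceT cf.
- have cF t : {for t, continuous F}.
    by apply: differentiable_continuous; apply/derivable1_diffP; exact: ex_derive.
  split => [t _||]; first exact: ex_derive.
    by apply: cvg_at_right_filter; exact: cF.
  by apply: cvg_at_left_filter; exact: cF.
- by move=> t _; rewrite derive1E; apply: derive_val.
Qed.

Lemma derive1_trig2 (a b c t : R) :
  derive1 (fun u => a + b * cos (u + u) + c * sin (u + u)) t =
  2 * (c * cos (t + t) - b * sin (t + t)).
Proof.
rewrite derive1E.
have -> : (fun u => a + b * cos (u + u) + c * sin (u + u)) =
  (fun u => a + b * (cos u * cos u - sin u * sin u)
            + c * (sin u * cos u + cos u * sin u)).
  by apply/funext => u; rewrite cosD sinD.
apply: derive_val; apply: is_derive_eq.
by rewrite cos_dbl sin_dbl /GRing.scale /=; ring.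
Qed.

(* The functions used here are finite sums of products of continuous functions
   of one coordinate: this class is stable under averaging over a coordinate,
   so no joint measurability argument is needed. *)
Inductive separable (P : nat) : ((nat -> R) -> R) -> Prop :=
| separable_prod (c : R) (h : nat -> R -> R) :
    (forall k, continuous (h k)) ->
    separable P (fun th => c * \prod_(k < P) h k (th k))
| separableD u v : separable P u -> separable P v ->
    separable P (fun th => u th + v th).

(** * Closure properties of separable functions *)

Lemma eq_separable P u v : u =1 v -> separable P u -> separable P v.
Proof. by move=> /funext->. Qed.

Lemma separable_cst P c : separable P (fun=> c).
Proof.
apply: (eq_separable _ (fun=> c * \prod_(k < P) 1)).
  by move=> th; rewrite big1 ?mulr1.
by apply: (separable_prod _ _ (fun=> fun=> 1)) => k t; exact: cvg_cst.
Qed.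

Lemma separableZ P c u : separable P u -> separable P (fun th => c * u th).
Proof.
elim=> [a h ch|v w _ IHv _ IHw].
  apply: (eq_separable _ (fun th => c * a * \prod_(k < P) h k (th k))).
    by move=> th; rewrite mulrA.
  exact: separable_prod.
by apply: eq_separable (separableD _ _ _ IHv IHw) => th; rewrite mulrDr.
Qed.

Lemma separableM P u v :
  separable P u -> separable P v -> separable P (fun th => u th * v th).
Proof.
move=> su sv; elim: su => [a h ch|u1 u2 _ IH1 _ IH2]; last first.
  by apply: eq_separable (separableD _ _ _ IH1 IH2) => th; rewrite mulrDl.
elim: sv => [b g cg|u1 u2 _ IH1 _ IH2]; last first.
  by apply: eq_separable (separableD _ _ _ IH1 IH2) => th; rewrite mulrDr.
apply: (eq_separable _ (fun th => a * b *
    \prod_(k < P) (fun i t => h i t * g i t) k (th k))) => [th|].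
  by rewrite big_split /= mulrACA.
apply: (separable_prod _ _ (fun i t => h i t * g i t)) => k t.
by apply: cvgM; [exact: ch|exact: cg].
Qed.

Lemma separable_snoc P u (h : R -> R) : continuous h -> separable P u ->
  separable P.+1 (fun th => h (th P) * u th).
Proof.
move=> ch; elim=> [a g cg|u1 u2 _ IH1 _ IH2]; last first.
  by apply: eq_separable (separableD _ _ _ IH1 IH2) => th; rewrite mulrDr.
apply: (eq_separable _ (fun th => a *
    \prod_(k < P.+1) (fun i => if i == P then h else g i) k (th k))) => [th|].
  rewrite big_ord_recr /= eqxx mulrA mulrC; congr (_ * (_ * _)).
  by apply: eq_bigr => k _; rewrite ltn_eqF.
apply: (separable_prod _ _ (fun i => if i == P then h else g i)) => k.
by case: ifP.
Qed.

(** The shift is absorbed into the [j]-th factor, which stays continuous. *)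
Lemma separable_shift P u j a : separable P u ->
  separable P (fun th => u (upd R th j (th j + a))).
Proof.
elim=> [c h ch|u1 u2 _ IH1 _ IH2]; last exact: (separableD _ _ _ IH1 IH2).
apply: (eq_separable _ (fun th => c *
    \prod_(k < P) (fun i t => if i == j then h i (t + a) else h i t) k (th k))).
  move=> th /=; congr (_ * _); apply: eq_bigr => k _.
  by rewrite /upd; case: eqP => [->|].
apply: (separable_prod _ _ (fun i t => if i == j then h i (t + a) else h i t)).
move=> k; case: (k == j) => t; last exact: ch.
apply: (@continuous_comp _ _ _ (fun t => t + a) (h k)); last exact: ch.
by apply: cvgD; [exact: cvg_id|exact: cvg_cst].
Qed.

Lemma separable_sum (I : Type) (r : seq I) (F : I -> (nat -> R) -> R) P :
  (forall i, separable P (F i)) -> separable P (fun th => \sum_(i <- r) F i th).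
Proof.
move=> sF; elim: r => [|i r IHr].
  by apply: eq_separable (separable_cst P 0) => th; rewrite big_nil.
by apply: eq_separable (separableD _ _ _ (sF i) IHr) => th; rewrite big_cons.
Qed.

Lemma separable_continuous P u th j : separable P u ->
  continuous (fun t => u (upd R th j t)).
Proof.
elim=> [c h ch|u1 u2 _ IH1 _ IH2] t; last by apply: cvgD; [exact: IH1|exact: IH2].
apply: cvgM; first exact: cvg_cst.
elim: P => [|P IHP].
  by under eq_fun do rewrite big_ord0; rewrite big_ord0; exact: cvg_cst.
under eq_fun do rewrite big_ord_recr /=.
rewrite big_ord_recr /=; apply: cvgM => //.
by rewrite /upd; case: eqP => _; [exact: ch|exact: cvg_cst].
Qed.

(** In a product, only the last factor depends on the averaged coordinate, and its average is a
    constant. *)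
Lemma separable_avg P u : separable P.+1 u ->
  separable P (fun th => avg (fun t => u (upd R th P t))).
Proof.
elim=> [c h ch|u1 u2 s1 IH1 s2 IH2]; last first.
  apply: eq_separable (separableD _ _ _ IH1 IH2) => th.
  by rewrite avgD //; apply: separable_continuous; eassumption.
apply: (eq_separable _ (fun th => c * avg (h P) * \prod_(k < P) h k (th k))).
  move=> th; rewrite mulrAC -avgZ //; congr avg; apply/funext => t.
  rewrite big_ord_recr /= mulrA /upd eqxx; congr (_ * _ * _).
  by apply: eq_bigr => k _; rewrite ltn_eqF.
exact: separable_prod.
Qed.

(** * Linearity and monotonicity of the iterated expectation *)

Lemma expectS P u :
  expect R P.+1 u = expect R P (fun th => avg (fun t => u (upd R th P t))).
Proof. by []. Qed.

Lemma expectD P u v : separable P u -> separable P v ->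
  expect R P (fun th => u th + v th) = expect R P u + expect R P v.
Proof.
elim: P u v => [|P IHP] u v su sv //.
rewrite !expectS -IHP; [|exact: separable_avg|exact: separable_avg].
congr expect; apply/funext => th.
by rewrite avgD //; apply: separable_continuous; eassumption.
Qed.

Lemma expectZ P c u : separable P u ->
  expect R P (fun th => c * u th) = c * expect R P u.
Proof.
elim: P u => [|P IHP] u su //.
rewrite !expectS -IHP; last exact: separable_avg.
congr expect; apply/funext => th.
by rewrite avgZ //; apply: separable_continuous; eassumption.
Qed.

Lemma expect_cst P c : expect R P (fun=> c) = c.
Proof.
elim: P => // P IHP; rewrite expectS -[RHS]IHP; congr expect.
by apply/funext => th; rewrite avg_cst.
Qed.

Lemma expect_ge0 P u : (forall th, 0 <= u th) -> 0 <= expect R P u.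
Proof.
elim: P u => [|P IHP] u u0; first exact: u0.
by rewrite expectS; apply: IHP => th; apply: avg_ge0.
Qed.

Lemma expect_le P u v : separable P u -> separable P v ->
  (forall th, u th <= v th) -> expect R P u <= expect R P v.
Proof.
move=> su sv uv; rewrite -subr_ge0 -mulN1r -expectZ // -expectD //.
  by apply: expect_ge0 => th; rewrite mulN1r subr_ge0.
exact: separableZ.
Qed.

Lemma expect_sum (I : Type) (r : seq I) (F : I -> (nat -> R) -> R) P :
  (forall i, separable P (F i)) ->
  expect R P (fun th => \sum_(i <- r) F i th) = \sum_(i <- r) expect R P (F i).
Proof.
move=> sF; elim: r => [|i r IHr].
  by under eq_fun do rewrite big_nil; rewrite big_nil expect_cst.
under eq_fun do rewrite big_cons; rewrite big_cons expectD ?IHr //.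
exact: separable_sum.
Qed.

End Averages.

(** * Expectations along a circuit *)

Definition is_rot (g : gate) : bool := if g is RotG _ then true else false.

Definition rot_qubits (s : seq gate) : seq nat :=
  pmap (fun g => if g is RotG q then Some q else None) s.

(* Controls on qubit 1 are excluded so that every gate but the rotations of
   qubit 1 preserves the observable [sigma_1] on qubit 1. *)
Definition valid_gate (n : nat) (g : gate) : bool :=
  match g with
  | RotG q => (1 <= q <= n)%N
  | CXG c t => [&& (1 < c <= n)%N, (1 <= t <= n)%N & c != t]
  end.

Lemma size_rot_qubits s : size (rot_qubits s) = nparams s.
Proof. by elim: s => [|[q|c t] s IHs] //=; rewrite IHs. Qed.

Lemma nparams_rcons s g : nparams (rcons s g) = (nparams s + is_rot g)%N.
Proof. by rewrite /nparams -cats1 count_cat /= addn0; case: g. Qed.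

Lemma rot_qubits_rcons s g : rot_qubits (rcons s g) =
  rot_qubits s ++ (if g is RotG q then [:: q] else [::]).
Proof. by rewrite /rot_qubits -cats1 pmap_cat; case: g. Qed.

Section Circuits.
Variables (R : realType) (n : nat) (rho : 'M[R[i]]_(2 ^ n)).
Local Notation M := 'M[R[i]]_(2 ^ n).
Local Notation X := (X1_mx R n).
Local Notation Z := (Z1_mx R n).
Implicit Types (th : nat -> R) (O : M) (s : seq gate) (g : gate).

Definition gate_mx (t : R) g : M :=
  match g with RotG q => rot_mx R n q t | CXG c u => cnot_mx R n c u end.

(** Heisenberg picture: the observable is pulled back through the gate. *)
Definition conj_gate (t : R) g O : M :=
  adj_mx R (gate_mx t g) *m O *m gate_mx t g.

Lemma circ_aux_rcons s g th k (A : M) : circ_aux R n th k (rcons s g) A =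
  gate_mx (th (k + nparams s)%N) g *m circ_aux R n th k s A.
Proof.
elim: s k A => [|[q|c t] s IHs] k A /=.
- by case: g => [q|c t] //=; rewrite /nparams /= addn0.
- by rewrite IHs addSnnS.
- by rewrite IHs.
Qed.

Lemma circuit_mx_rcons s g th : circuit_mx R n (rcons s g) th =
  gate_mx (th (nparams s)) g *m circuit_mx R n s th.
Proof. exact: circ_aux_rcons. Qed.

Definition ev s th O : R :=
  complex.Re (\tr (O *m circuit_mx R n s th *m rho *m
                   adj_mx R (circuit_mx R n s th))).

Lemma ev_nil th O : ev [::] th O = complex.Re (\tr (O *m rho)).
Proof. by rewrite /ev /circuit_mx /= adj_mx1 !mulmx1. Qed.

(** Cyclicity of the trace moves the last gate onto the observable. This is why circuits are
    inducted on from their end, which also carries the last parameter, the first one integrated by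
    [expect]. *)
Lemma ev_rcons s g th O :
  ev (rcons s g) th O = ev s th (conj_gate (th (nparams s)) g O).
Proof.
rewrite /ev circuit_mx_rcons adj_mxM /conj_gate !mulmxA.
by rewrite mxtrace_mulC !mulmxA.
Qed.

Lemma evD s th O1 O2 : ev s th (O1 + O2) = ev s th O1 + ev s th O2.
Proof. by rewrite /ev !mulmxDl linearD raddfD. Qed.

Lemma Re_realM (a : R) (z : R[i]) : complex.Re (a%:C%C * z) = a * complex.Re z.
Proof. by case: z => x y /=; rewrite mul0r subr0. Qed.

Lemma evZ s th a O : ev s th (a%:C%C *: O) = a * ev s th O.
Proof. by rewrite /ev -!scalemxAl linearZ /= Re_realM. Qed.

Lemma evN s th O : ev s th (- O) = - ev s th O.
Proof. by rewrite -scaleN1r -(rmorphN1 (real_complex R)) evZ mulN1r. Qed.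

Lemma ev_upd s th k t O : (nparams s <= k)%N -> ev s (upd R th k t) O = ev s th O.
Proof.
elim/last_ind: s O => [|s g IHs] O; first by rewrite !ev_nil.
rewrite nparams_rcons !ev_rcons => le_k; rewrite IHs; last by lia.
congr ev; case: g le_k => //= q le_k.
by rewrite /upd ltn_eqF //; lia.
Qed.

Lemma ev_rot s th q O : (1 <= q <= n)%N ->
  ev (rcons s (RotG q)) th O =
  cos (th (nparams s)) ^+ 2 * ev s th O
  + sin (th (nparams s)) ^+ 2 * ev s th (- (Jmx R n q *m O *m Jmx R n q))
  + cos (th (nparams s)) * sin (th (nparams s)) *
      ev s th (O *m Jmx R n q - Jmx R n q *m O).
Proof.
move=> qn; rewrite ev_rcons /conj_gate /= (rot_conj _ _ _ _ _ qn) -scalerN evD.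
by rewrite (evD _ _ (_ *: O)) !evZ.
Qed.

(** Each rotation adds one coordinate, which enters through the three coefficients of [ev_rot]. *)
Lemma ev_separable s O : all (valid_gate n) s ->
  separable R (nparams s) (fun th => ev s th O).
Proof.
elim/last_ind: s O => [|s g IHs] O.
  move=> _; apply: eq_separable (separable_cst R 0 (complex.Re (\tr (O *m rho)))).
  by move=> th; rewrite ev_nil.
rewrite all_rcons nparams_rcons => /andP[vg vs].
case: g vg => [q|c t] vg; last first.
  (* A CNOT ignores its parameter, so 0 is a dummy value. *)
  rewrite addn0; apply: eq_separable (IHs (conj_gate 0 (CXG c t) O) vs) => th.
  by rewrite ev_rcons.
rewrite addn1.
apply: (eq_separable R _ _ _ (fun th => esym (ev_rot s th q O vg))).
apply: separableD; first apply: separableD.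
- apply: (separable_snoc R _ _ (fun t => cos t ^+ 2)); last exact: IHs.
  exact: continuous_sqr (@continuous_cos R).
- apply: (separable_snoc R _ _ (fun t => sin t ^+ 2)); last exact: IHs.
  exact: continuous_sqr (@continuous_sin R).
- apply: (separable_snoc R _ _ (fun t => cos t * sin t)); last exact: IHs.
  move=> t; apply: cvgM; [exact: continuous_cos|exact: continuous_sin].
Qed.

(** Gates after rotation [j] only change the observable, and gates before it do not see parameter
    [j]; at the rotation itself the squares and product of [ev_rot] become functions of the doubled
    angle. *)
Lemma ev_trig s th j O : all (valid_gate n) s ->
  exists a b c, forall t,
    ev s (upd R th j t) O = a + b * cos (t + t) + c * sin (t + t).
Proof.
elim/last_ind: s O => [|s g IHs] O.
  move=> _; exists (ev [::] th O), 0, 0 => t.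
  by rewrite !ev_nil !mul0r !addr0.
rewrite all_rcons => /andP[vg vs].
have [jP|jP] := eqVneq j (nparams s); last first.
  have [a [b [c abc]]] := IHs (conj_gate (th (nparams s)) g O) vs.
  exists a, b, c => t; rewrite ev_rcons -abc {2}/upd.
  by rewrite eq_sym (negPf jP).
(* If the last gate is a CNOT, index [j] is beyond all parameters and the expectation is constant in
   it. *)
case: g vg => [q|c u] vg; last first.
  exists (ev (rcons s (CXG c u)) th O), 0, 0 => t.
  by rewrite !ev_rcons jP ev_upd // !mul0r !addr0.
exists ((ev s th O + ev s th (- (Jmx R n q *m O *m Jmx R n q))) / 2),
  ((ev s th O - ev s th (- (Jmx R n q *m O *m Jmx R n q))) / 2),
  (ev s th (O *m Jmx R n q - Jmx R n q *m O) / 2) => t.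
by rewrite ev_rot // jP /upd eqxx -/(upd R th (nparams s) t) !ev_upd // half_angles.
Qed.

(** The derivative of [ev s] in parameter [j], written in shift form: it is visibly linear in [O]
    and inherits separability from [ev]. *)
Definition dev s j th O : R :=
  ev s (upd R th j (th j + pi / 4)) O - ev s (upd R th j (th j + - (pi / 4))) O.

(* parameter-shift rule *)
Lemma partial_objective s j th : all (valid_gate n) s ->
  partial R (objective R n s rho) j th = 2^-1 * dev s j th Z.
Proof.
move=> vs; have [a [b [c abc]]] := ev_trig s th j Z vs.
rewrite /partial.
have -> : (fun t => objective R n s rho (upd R th j t)) =
    (fun t => (2^-1 + 2^-1 * a) + 2^-1 * b * cos (t + t) + 2^-1 * c * sin (t + t)).
  apply/funext => t; rewrite /objective -/(ev s (upd R th j t) Z) abc.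
  by move: (cos _) (sin _) => x y; ring.
rewrite derive1_trig2 /dev !abc dbl_shift_quarter_pi dbl_shift_quarter_piN.
rewrite cosDpihalf sinDpihalf cosBpihalf sinBpihalf.
by move: (cos _) (sin _) => x y; field.
Qed.

Lemma dev_separable s j O : all (valid_gate n) s ->
  separable R (nparams s) (fun th => dev s j th O).
Proof.
move=> vs; have se := ev_separable s O vs.
apply: (eq_separable R _ (fun th =>
   ev s (upd R th j (th j + pi / 4)) O +
   (-1) * ev s (upd R th j (th j + - (pi / 4))) O)).
  by move=> th; rewrite mulN1r.
apply: separableD; first exact: (separable_shift R _ (fun th => ev s th O)).
by apply: separableZ; exact: (separable_shift R _ (fun th => ev s th O)).
Qed.

(** * Upper bound on the gradient *)

Lemma circuit_unitary s th : all (valid_gate n) s ->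
  adj_mx R (circuit_mx R n s th) *m circuit_mx R n s th = 1%:M.
Proof.
elim/last_ind: s => [|s g IHs]; first by rewrite /circuit_mx /= adj_mx1 mulmx1.
rewrite all_rcons => /andP[vg vs]; rewrite circuit_mx_rcons adj_mxM.
rewrite mulmxA -(mulmxA (adj_mx R _)).
suff -> : adj_mx R (gate_mx (th (nparams s)) g) *m gate_mx (th (nparams s)) g = 1%:M.
  by rewrite mulmx1 IHs.
case: g vg => [q|c t] /= vg; first exact: rot_unitary.
by case/and3P: vg => cn tn ct; apply: cnot_unitary => //; lia.
Qed.

(** The diagonal of the evolved state is a probability distribution, and the diagonal observable has
    entries 1 and - 1. *)
Lemma ev_Z_bound s th : density_matrix R rho -> all (valid_gate n) s ->
  `|ev s th Z| <= 1.
Proof.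
move=> [_ rho_ge0 tr1] vs; rewrite /ev -!mulmxA.
set V := circuit_mx R n s th; set A := V *m (rho *m adj_mx R V).
have A_ge0 i : 0 <= A i i.
  (* [A i i] is the quadratic form of [rho] at the i-th column of the adjoint of [V]. *)
  have := rho_ge0 (col i (adj_mx R V)).
  have -> : (map_mx conjc (col i (adj_mx R V)))^T = row i V.
    by apply/matrixP => k j; rewrite !mxE conjcK.
  rewrite -row_mul /A mulmxA !mxE.
  by congr (0 <= _); apply: eq_bigr => k _; rewrite [row _ _ _ _]mxE [col _ _ _ _]mxE.
have trA : \tr A = 1.
  by rewrite /A mxtrace_mulC -mulmxA circuit_unitary // mulmx1.
have -> : complex.Re (\tr (Z *m A)) =
    \sum_(i < 2 ^ n) complex.Re (- sgnb R (qbit n 1 i)) * complex.Re (A i i).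
  rewrite Z1_mxE mulmx_pick /mxtrace raddf_sum; apply: eq_bigr => i _.
  by rewrite mxE /sgnb; case: (A i i) => x y; case: qbit => /=; ring.
have -> : 1 = \sum_(i < 2 ^ n) complex.Re (A i i).
  by rewrite -raddf_sum -/(mxtrace A) trA.
apply: le_trans (ler_norm_sum _ _ _) _; apply: ler_sum => i _.
rewrite normrM; have := A_ge0 i; case: (A i i) => x y; rewrite lecE /= => /andP[_ x0].
rewrite (ger0_norm x0) /sgnb; case: qbit => /=;
  by rewrite ?oppr0 ?opprK ?normrN normr1 mul1r.
Qed.

(** Two numbers in [-1, 1] differ by at most 2, and the shift rule halves the difference. *)
Lemma partial_objective_bound s j th : density_matrix R rho ->
  all (valid_gate n) s -> partial R (objective R n s rho) j th ^+ 2 <= 1.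
Proof.
move=> drho vs; rewrite partial_objective // /dev.
have := ev_Z_bound s (upd R th j (th j + pi / 4)) drho vs.
have := ev_Z_bound s (upd R th j (th j + - (pi / 4))) drho vs.
move: (ev s _ Z) (ev s _ Z) => x y; rewrite !ler_norml.
by move=> /andP[x1 x2] /andP[y1 y2]; nra.
Qed.

Lemma partial_separable s j : all (valid_gate n) s ->
  separable R (nparams s) (fun th => partial R (objective R n s rho) j th ^+ 2).
Proof.
move=> vs; apply: (eq_separable R _ (fun th =>
  (2^-1 * dev s j th Z) * (2^-1 * dev s j th Z))).
  by move=> th; rewrite partial_objective // expr2.
by apply: separableM; apply: separableZ; exact: dev_separable.
Qed.

Lemma expect_grad_le s : density_matrix R rho -> all (valid_gate n) s ->
  expect R (nparams s) (grad_sqnorm R (nparams s) (objective R n s rho)) <=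
  (nparams s)%:R.
Proof.
move=> drho vs; rewrite -[leRHS](expect_cst R (nparams s)); apply: expect_le.
- by apply: separable_sum => j; exact: partial_separable.
- exact: separable_cst.
move=> th; rewrite /grad_sqnorm.
apply: (@le_trans _ _ (\sum_(k < nparams s) 1)).
  by apply: ler_sum => k _; exact: partial_objective_bound.
by rewrite sumr_const card_ord.
Qed.

(* Abstracts the two families [ev s] and [dev s j] with [j < nparams s]. *)
Definition linear_family (P : nat) (L : (nat -> R) -> M -> R) : Prop :=
  [/\ forall th O1 O2, L th (O1 + O2) = L th O1 + L th O2,
      forall th (a : R) O, L th (a%:C%C *: O) = a * L th O,
      forall O, separable R P (fun th => L th O)
    & forall th t O, L (upd R th P t) O = L th O].

Lemma ev_family s : all (valid_gate n) s -> linear_family (nparams s) (ev s).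
Proof.
move=> vs; split; [exact: evD | exact: evZ | | by move=> *; rewrite ev_upd].
by move=> O; exact: ev_separable.
Qed.

Lemma upd_upd th j k t u : j != k ->
  upd R (upd R th j t) k u = upd R (upd R th k u) j t.
Proof.
move=> jk; apply/funext => i; rewrite /upd; case: (eqVneq i k) => // ->.
by rewrite eq_sym (negPf jk).
Qed.

(** As [j] is below [nparams s], the shift at [j] commutes with an update at the next free index. *)
Lemma dev_family s j : all (valid_gate n) s -> (j < nparams s)%N ->
  linear_family (nparams s) (dev s j).
Proof.
move=> vs jP; split=> [th O1 O2|th a O|O|th t O].
- by rewrite /dev !evD opprD addrACA.
- by rewrite /dev !evZ mulrBr.
- exact: dev_separable.
- have jne : nparams s != j by rewrite gtn_eqF.
  have -> : dev s j (upd R th (nparams s) t) O =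
      ev s (upd R (upd R th (nparams s) t) j (th j + pi / 4)) O -
      ev s (upd R (upd R th (nparams s) t) j (th j + - (pi / 4))) O.
    have eqj : upd R th (nparams s) t j = th j by rewrite /upd ltn_eqF.
    by rewrite /dev eqj.
  rewrite /dev (upd_upd _ _ _ _ _ jne).
  by rewrite (upd_upd _ _ _ _ (th j + - (pi / 4)) jne) !(ev_upd s _ (nparams s)).
Qed.

(** * Lower bound on the gradient *)

Definition rot1 g : bool := if g is RotG q then q == 1%N else false.

Hypothesis n_gt0 : (0 < n)%N.

(** Lifts [avg_sqr_trig2] to the last coordinate: [u] and [v] are constants for the inner
    average. *)
Lemma expect_trig2 P (u v w : (nat -> R) -> R) :
  (forall th t, u (upd R th P t) = u th) ->
  (forall th t, v (upd R th P t) = v th) ->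
  (forall th, w th = u th * cos (th P + th P) + v th * sin (th P + th P)) ->
  expect R P.+1 (fun th => w th ^+ 2) =
  expect R P (fun th => (u th ^+ 2 + v th ^+ 2) / 2).
Proof.
move=> uP vP wE; rewrite expectS; congr expect; apply/funext => th.
rewrite -avg_sqr_trig2; congr avg; apply/funext => t.
by rewrite wE uP vP /upd eqxx.
Qed.

Lemma linear_family_sqr P L O : linear_family P L ->
  separable R P (fun th => L th O ^+ 2).
Proof.
move=> [_ _ sL _]; apply: (eq_separable R _ (fun th => L th O * L th O)).
  by move=> th; rewrite expr2.
exact: separableM.
Qed.

Lemma expect_half_sum P L O1 O2 : linear_family P L ->
  expect R P (fun th => (L th O1 ^+ 2 + L th O2 ^+ 2) / 2) =
  (expect R P (fun th => L th O1 ^+ 2) + expect R P (fun th => L th O2 ^+ 2)) / 2.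
Proof.
move=> fL; rewrite -expectD; [|exact: linear_family_sqr..].
rewrite [RHS]mulrC -expectZ.
  by congr expect; apply/funext => th; rewrite mulrC.
by apply: separableD; exact: linear_family_sqr.
Qed.

Lemma expect_sqr_ge0 P (L : (nat -> R) -> M -> R) O :
  0 <= expect R P (fun th => L th O ^+ 2).
Proof. by apply: expect_ge0 => th; exact: sqr_ge0. Qed.

Lemma expect_X1_rot1 P L : linear_family P L ->
  expect R P.+1 (fun th => L th (conj_gate (th P) (RotG 1) X) ^+ 2) =
  expect R P (fun th => (L th X ^+ 2 + L th Z ^+ 2) / 2).
Proof.
move=> [LD LZ _ Lupd].
rewrite (expect_trig2 P (fun th => L th X) (fun th => L th Z)
  (fun th => L th (conj_gate (th P) (RotG 1) X))) // => th.
by rewrite /conj_gate /= (rot1_conj_X1 _ _ _ n_gt0) LD !LZ ![_ * L _ _]mulrC.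
Qed.

Lemma expect_Z1_rot1 P L : linear_family P L ->
  expect R P.+1 (fun th => L th (conj_gate (th P) (RotG 1) Z) ^+ 2) =
  expect R P (fun th => (L th X ^+ 2 + L th Z ^+ 2) / 2).
Proof.
move=> [LD LZ _ Lupd].
rewrite (expect_trig2 P (fun th => L th Z) (fun th => - L th X)
  (fun th => L th (conj_gate (th P) (RotG 1) Z))) // => [|th t|th].
- by congr expect; apply/funext => th; rewrite sqrrN addrC.
- by rewrite Lupd.
rewrite /conj_gate /= (rot1_conj_Z1 _ _ _ n_gt0) -scaleNr -rmorphN LD !LZ.
by rewrite mulNr [cos _ * _]mulrC [sin _ * _]mulrC mulNr.
Qed.

(** Only a rotation of qubit 1 costs a factor 2, the square of the sigma_3 expectation being
    dropped. The boolean [rot1 g] serves as the exponent 0 or 1. *)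
Lemma expect_X1_step P L g : linear_family P L -> valid_gate n g ->
  expect R P (fun th => L th X ^+ 2) / 2 ^+ rot1 g <=
  expect R (P + is_rot g) (fun th => L th (conj_gate (th P) g X) ^+ 2).
Proof.
move=> fL; case: g => [q|c t] /= vg; last first.
  rewrite addn0 expr0 divr1 /conj_gate /=; case/and3P: vg => cn tn ct.
  have c1 : c != 1%N by lia.
  have {}cn : (1 <= c <= n)%N by lia.
  by rewrite (cnot_conj_X1 _ _ _ _ n_gt0 c1 cn tn ct).
rewrite addn1; case: (eqVneq q 1%N) => [->|q1].
  rewrite expr1 (expect_X1_rot1 _ _ fL) expect_half_sum // ler_pM2r ?invr_gt0 // lerDl.
  exact: expect_sqr_ge0.
(* On another qubit the new parameter does not occur after conjugation, so a constant is
   averaged. *)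
rewrite expr0 divr1 expectS le_eqVlt; apply/orP; left; apply/eqP.
congr expect; apply/funext => th; case: fL => _ _ _ Lupd.
rewrite -[LHS]avg_cst; congr avg; apply/funext => t.
by rewrite Lupd /conj_gate /= (rot_conj_X1 _ _ _ _ n_gt0 q1 vg).
Qed.

Lemma dev_rcons s g j th O : (j < nparams s)%N ->
  dev (rcons s g) j th O = dev s j th (conj_gate (th (nparams s)) g O).
Proof.
move=> jP; have eqP t : upd R th j t (nparams s) = th (nparams s).
  by rewrite /upd gtn_eqF.
by rewrite /dev !ev_rcons !eqP.
Qed.

Lemma dev_last_conj s th O :
  let P := nparams s in
  dev (rcons s (RotG 1)) P th O =
  ev s th (conj_gate (th P + pi / 4) (RotG 1) O) -
  ev s th (conj_gate (th P - pi / 4) (RotG 1) O).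
Proof.
move=> P; have updP t : upd R th P t P = t by rewrite /upd eqxx.
by rewrite /dev !ev_rcons !updP !(ev_upd _ _ _ _ _ (leqnn P)).
Qed.

Lemma dev_last_X1 s th :
  dev (rcons s (RotG 1)) (nparams s) th X =
  2 * ev s th Z * cos (th (nparams s) + th (nparams s)) +
  (- 2 * ev s th X) * sin (th (nparams s) + th (nparams s)).
Proof.
rewrite dev_last_conj /conj_gate /= !(rot1_conj_X1 _ _ _ n_gt0) !evD !evZ.
rewrite dbl_shift_quarter_pi dbl_shift_quarter_piN.
rewrite cosDpihalf sinDpihalf cosBpihalf sinBpihalf.
by move: (cos _) (sin _) (ev _ _ X) (ev _ _ Z) => c d x z; ring.
Qed.

Lemma dev_last_Z1 s th :
  dev (rcons s (RotG 1)) (nparams s) th Z =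
  (- 2 * ev s th X) * cos (th (nparams s) + th (nparams s)) +
  (- 2 * ev s th Z) * sin (th (nparams s) + th (nparams s)).
Proof.
rewrite dev_last_conj /conj_gate /= !(rot1_conj_Z1 _ _ _ n_gt0) !evD !evN !evZ.
rewrite dbl_shift_quarter_pi dbl_shift_quarter_piN.
rewrite cosDpihalf sinDpihalf cosBpihalf sinBpihalf.
by move: (cos _) (sin _) (ev _ _ X) (ev _ _ Z) => c d x z; ring.
Qed.

(** For either observable the derivative is again a combination of the doubled-angle cosine and
    sine, with coefficients 2 x and 2 z up to sign and order; averaging its square gives 2 (x^2 +
    z^2). *)
Lemma expect_dev_last s O : O = X \/ O = Z -> all (valid_gate n) s ->
  expect R (nparams s).+1 (fun th => dev (rcons s (RotG 1)) (nparams s) th O ^+ 2) =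
  2 * (expect R (nparams s) (fun th => ev s th X ^+ 2) +
       expect R (nparams s) (fun th => ev s th Z ^+ 2)).
Proof.
move=> OXZ vs; have fL := ev_family s vs.
rewrite -expectD; [|exact: linear_family_sqr..].
rewrite -expectZ; last by apply: separableD; exact: linear_family_sqr.
case: OXZ => ->.
  rewrite (expect_trig2 _ (fun th => 2 * ev s th Z) (fun th => - 2 * ev s th X)).
  - congr expect; apply/funext => th.
    by move: (ev _ _ X) (ev _ _ Z) => x z; field.
  - by move=> th t; rewrite ev_upd.
  - by move=> th t; rewrite ev_upd.
  - exact: dev_last_X1.
rewrite (expect_trig2 _ (fun th => - 2 * ev s th X) (fun th => - 2 * ev s th Z)).
- congr expect; apply/funext => th.
  by move: (ev _ _ X) (ev _ _ Z) => x z; field.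
- by move=> th t; rewrite ev_upd.
- by move=> th t; rewrite ev_upd.
- exact: dev_last_Z1.
Qed.

Definition nrot1 s : nat := count_mem 1%N (rot_qubits s).

Lemma nrot1_rcons s g : nrot1 (rcons s g) = (nrot1 s + rot1 g)%N.
Proof.
by rewrite /nrot1 rot_qubits_rcons count_cat; case: g => //= q; rewrite addn0.
Qed.

Lemma alphaE th : alpha R rho = ev [::] th X ^+ 2 + ev [::] th Z ^+ 2.
Proof. by rewrite !ev_nil. Qed.

(** The initial rotation of qubit 1 mixes both observables and yields exactly [alpha / 2]; from
    there [expect_X1_step] is iterated. *)
Lemma expect_ev_X1_ge s : all (valid_gate n) (RotG 1 :: s) ->
  alpha R rho / 2 ^+ nrot1 (RotG 1 :: s) <=
  expect R (nparams (RotG 1 :: s)) (fun th => ev (RotG 1 :: s) th X ^+ 2).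
Proof.
elim/last_ind: s => [|s g IHs].
  move=> _; rewrite -[[:: RotG 1]]/(rcons [::] (RotG 1)).
  under [X in expect _ _ X]eq_fun do rewrite ev_rcons.
  rewrite nparams_rcons expect_X1_rot1; last exact: ev_family.
  by rewrite /= -alphaE.
rewrite -rcons_cons all_rcons => /andP[vg vs].
under [X in expect _ _ X]eq_fun do rewrite ev_rcons.
rewrite nparams_rcons nrot1_rcons exprD invfM mulrA.
apply: le_trans (expect_X1_step _ _ _ (ev_family _ vs) vg).
by rewrite ler_pM2r ?invr_gt0 ?exprn_gt0 //; exact: IHs.
Qed.

(** If K counts the rotations of qubit 1, K - 1 of them precede the last gate, so twice the lower
    bound alpha / 2^(K-1) gives 4 alpha / 2^K. *)
Lemma expect_dev_last_ge s O : O = X \/ O = Z ->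
  all (valid_gate n) (RotG 1 :: s) ->
  4 * (alpha R rho / 2 ^+ nrot1 (rcons (RotG 1 :: s) (RotG 1))) <=
  expect R (nparams (RotG 1 :: s)).+1
    (fun th => dev (rcons (RotG 1 :: s) (RotG 1)) (nparams (RotG 1 :: s)) th O ^+ 2).
Proof.
move=> OXZ vs; rewrite (expect_dev_last _ _ OXZ vs) nrot1_rcons exprD invfM.
have half_bound (a p x z : R) : a / p <= x -> 0 <= z ->
    4 * (a * (p^-1 * (2 ^+ 1)^-1)) <= 2 * (x + z).
  by rewrite (mulrA a) expr1; move: (a / p) => b; lra.
by apply: half_bound; [exact: expect_ev_X1_ge | exact: expect_sqr_ge0].
Qed.

(** Gates after rotation [j] are peeled off by [expect_X1_step] applied to the family [dev s j];
    once rotation [j] is the last gate, [expect_dev_last_ge] applies. *)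
Lemma expect_dev_X1_ge s j : all (valid_gate n) (RotG 1 :: s) ->
  (j < nparams (RotG 1 :: s))%N -> nth 0%N (rot_qubits (RotG 1 :: s)) j = 1%N ->
  4 * (alpha R rho / 2 ^+ nrot1 (RotG 1 :: s)) <=
  expect R (nparams (RotG 1 :: s)) (fun th => dev (RotG 1 :: s) j th X ^+ 2).
Proof.
elim/last_ind: s => [|s g IHs].
  move=> _; rewrite -[[:: RotG 1]]/(rcons [::] (RotG 1)) nparams_rcons.
  rewrite ltnS leqn0 => /eqP-> _.
  have /= := expect_dev_last [::] X (or_introl erefl) isT.
  rewrite -alphaE /= => ->.
  by rewrite /nrot1 /= expr1; move: (alpha _ _) => a; lra.
rewrite -rcons_cons all_rcons nparams_rcons rot_qubits_rcons => /andP[vg vs] jP.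
rewrite nth_cat size_rot_qubits; case: ltnP => [jlt|jge].
  move=> nthj.
  under [X in expect _ _ X]eq_fun do rewrite (dev_rcons _ _ _ _ _ jlt).
  rewrite nrot1_rcons exprD invfM 2!mulrA.
  apply: le_trans (expect_X1_step _ _ _ (dev_family _ _ vs jlt) vg).
  by rewrite ler_pM2r ?invr_gt0 ?exprn_gt0 // -mulrA; exact: IHs.
(* Here [j] is not a parameter of the shorter circuit, so the appended gate is rotation [j]
   itself. *)
case: g vg jP => [q|c t] vg jP; last by exfalso; move: jP; rewrite addn0; lia.
have -> : j = nparams (RotG 1 :: s).
  by apply/eqP; rewrite eqn_leq jge andbT -ltnS -[X in (_ < X)%N]addn1.
rewrite subnn /= => ->; rewrite addn1; apply: expect_dev_last_ge => //.
by left.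
Qed.

(** A CNOT onto qubit 1 does not preserve sigma_3 there, so the closing rotation of qubit 1 is used
    first: it turns half of the square into that of sigma_1, to which the previous bound applies. *)
Lemma expect_dev_Z1_ge s j :
  let s1 := rcons (RotG 1 :: s) (RotG 1) in all (valid_gate n) s1 ->
  (j < nparams s1)%N -> nth 0%N (rot_qubits s1) j = 1%N ->
  4 * (alpha R rho / 2 ^+ nrot1 s1) <=
  expect R (nparams s1) (fun th => dev s1 j th Z ^+ 2).
Proof.
move=> s1; rewrite /s1 all_rcons nparams_rcons rot_qubits_rcons addn1.
move=> /andP[_ vs] jP.
rewrite nth_cat size_rot_qubits; case: ltnP => [jlt|jge].
  move=> nthj.
  under [X in expect _ _ X]eq_fun do rewrite (dev_rcons _ _ _ _ _ jlt).
  have fL := dev_family _ _ vs jlt.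
  rewrite (expect_Z1_rot1 _ _ fL) (expect_half_sum _ _ _ _ fL).
  rewrite nrot1_rcons exprD invfM expr1 2!mulrA ler_pM2r ?invr_gt0 //.
  rewrite -mulrA; apply: le_trans (expect_dev_X1_ge _ _ vs jlt nthj) _.
  by rewrite lerDl; exact: expect_sqr_ge0.
have -> : j = nparams (RotG 1 :: s) by apply/eqP; rewrite eqn_leq jge -ltnS jP.
by move=> _; apply: expect_dev_last_ge => //; right.
Qed.

Lemma expect_grad_ge s :
  let s1 := rcons (RotG 1 :: s) (RotG 1) in all (valid_gate n) s1 ->
  (nrot1 s1)%:R / 2 ^+ nrot1 s1 * alpha R rho <=
  expect R (nparams s1) (grad_sqnorm R (nparams s1) (objective R n s1 rho)).
Proof.
move=> s1 vs; rewrite /grad_sqnorm expect_sum; last first.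
  by move=> j; exact: partial_separable.
(* The bound is spread over the parameters whose rotation acts on qubit 1; all other partial
   derivatives contribute at least 0. *)
have -> : (nrot1 s1)%:R / 2 ^+ nrot1 s1 * alpha R rho =
    \sum_(j < nparams s1 | nth 0%N (rot_qubits s1) j == 1%N)
      alpha R rho / 2 ^+ nrot1 s1.
  rewrite sumr_const mulrAC -mulrA mulr_natl; congr (_ *+ _).
  rewrite /nrot1 -sum1_count (big_nth 0%N) big_mkord size_rot_qubits.
  by rewrite sum1_card.
rewrite big_mkcond; apply: ler_sum => j _.
case: eqP => [nthj|_]; last by apply: expect_ge0 => th; exact: sqr_ge0.
have := expect_dev_Z1_ge s j vs (ltn_ord j) nthj; rewrite -/s1.
(* Squaring the factor 1/2 of the shift rule cancels the 4 in the bound on [dev]. *)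
have -> : (fun th => partial R (objective R n s1 rho) j th ^+ 2) =
          (fun th => 4^-1 * dev s1 j th Z ^+ 2).
  apply/funext => th; rewrite partial_objective // exprMn; congr (_ * _).
  by field.
rewrite expectZ; last exact: linear_family_sqr (dev_family _ _ vs (ltn_ord j)).
by move: (alpha _ _ / _) (expect _ _ _) => a b; lra.
Qed.

End Circuits.

(** * The tree-tensor and step-controlled circuits *)

Lemma rot_qubits_cat s1 s2 : rot_qubits (s1 ++ s2) = rot_qubits s1 ++ rot_qubits s2.
Proof. exact: pmap_cat. Qed.

Lemma nparams_cat s1 s2 : nparams (s1 ++ s2) = (nparams s1 + nparams s2)%N.
Proof. exact: count_cat. Qed.

Lemma nrot1_cat s1 s2 : nrot1 (s1 ++ s2) = (nrot1 s1 + nrot1 s2)%N.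
Proof. by rewrite /nrot1 rot_qubits_cat count_cat. Qed.

Lemma rot_qubits_map (h : nat -> nat) r :
  rot_qubits [seq RotG (h j) | j <- r] = map h r.
Proof. by elim: r => //= j r ->. Qed.

Lemma rot_qubits_cx (a b : nat -> nat) r :
  rot_qubits [seq CXG (a j) (b j) | j <- r] = [::].
Proof. by elim: r. Qed.

(** * The tree-tensor circuit *)

Lemma nparams_tt_rot_layer N l : nparams (tt_rot_layer N l) = (N %/ 2 ^ l.-1)%N.
Proof. by rewrite -size_rot_qubits rot_qubits_map size_map size_iota. Qed.

Lemma nparams_tt_cx_layer N l : nparams (tt_cx_layer N l) = 0%N.
Proof. by rewrite -size_rot_qubits rot_qubits_cx. Qed.

Lemma nrot1_tt_cx_layer N l : nrot1 (tt_cx_layer N l) = 0%N.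
Proof. by rewrite /nrot1 rot_qubits_cx. Qed.

Lemma nrot1_tt_rot_layer N l : (2 ^ l.-1 <= N)%N -> nrot1 (tt_rot_layer N l) = 1%N.
Proof.
move=> leN; rewrite /nrot1 rot_qubits_map count_map.
have : (0 < N %/ 2 ^ l.-1)%N by rewrite divn_gt0 // expn_gt0.
case: (N %/ 2 ^ l.-1)%N => //= k _.
(* Only [j = 0] addresses qubit 1. *)
rewrite (eq_in_count (a2 := pred0)) ?count_pred0 // => j.
rewrite mem_iota /= => /andP[j0 _]; apply/negbTE.
by rewrite addn1 eqSS muln_eq0 expn_eq0 /= orbF -lt0n.
Qed.

Lemma valid_tt_rot_layer N l : all (valid_gate N) (tt_rot_layer N l).
Proof.
rewrite all_map; apply/allP => j; rewrite mem_iota add0n /= => ltj.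
have d0 : (0 < 2 ^ l.-1)%N by rewrite expn_gt0.
move: ltj; rewrite leq_divRL // /valid_gate; move: (2 ^ l.-1)%N d0 => d d0.
by nia.
Qed.

Lemma valid_tt_cx_layer N l : (0 < l)%N -> all (valid_gate N) (tt_cx_layer N l).
Proof.
move=> l0; rewrite all_map; apply/allP => j; rewrite mem_iota add0n /= => ltj.
have d0 : (0 < 2 ^ l.-1)%N by rewrite expn_gt0.
have dE : (2 ^ l = 2 * 2 ^ l.-1)%N by rewrite -expnS prednK.
move: ltj; rewrite leq_divRL ?expn_gt0 // /valid_gate dE.
move: (2 ^ l.-1)%N d0 => d d0 le; apply/and3P; split; nia.
Qed.

Lemma iota_rcons i k : iota i k.+1 = rcons (iota i k) (i + k)%N.
Proof. by rewrite -addn1 iotaD cats1. Qed.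

Definition tt_layers (m k : nat) : seq gate :=
  flatten [seq tt_rot_layer (2 ^ m) l ++ tt_cx_layer (2 ^ m) l | l <- iota 1 k].

Lemma tt_layersS m k : tt_layers m k.+1 = tt_layers m k ++
  (tt_rot_layer (2 ^ m) k.+1 ++ tt_cx_layer (2 ^ m) k.+1).
Proof. by rewrite /tt_layers iota_rcons map_rcons flatten_rcons add1n. Qed.

Lemma valid_tt_circuit m : all (valid_gate (2 ^ m)) (tt_circuit m).
Proof.
rewrite /tt_circuit all_cat valid_tt_rot_layer andbT -/(tt_layers m m).
elim: {3}m => // k IHk.
by rewrite tt_layersS !all_cat IHk valid_tt_rot_layer valid_tt_cx_layer.
Qed.

(** A geometric sum, stated additively to avoid truncated subtraction. *)
Lemma nparams_tt_layers m k : (k <= m)%N ->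
  (nparams (tt_layers m k) + 2 ^ (m.+1 - k) = 2 ^ m.+1)%N.
Proof.
elim: k => [|k IHk] km; first by rewrite subn0.
rewrite tt_layersS !nparams_cat nparams_tt_rot_layer nparams_tt_cx_layer addn0 /=.
rewrite -[RHS](IHk (ltnW km)) -addnA; congr (_ + _)%N.
by rewrite -expnB ?(ltnW km) // subSS subSn ?(ltnW km) // expnS addnn mul2n.
Qed.

Lemma nrot1_tt_layers m k : (k <= m)%N -> nrot1 (tt_layers m k) = k.
Proof.
elim: k => [|k IHk] km //.
rewrite tt_layersS !nrot1_cat IHk ?(ltnW km) // nrot1_tt_rot_layer /=.
  by rewrite nrot1_tt_cx_layer addn0 addn1.
by rewrite leq_exp2l // ltnW.
Qed.

Lemma nparams_tt_circuit m : nparams (tt_circuit m) = (2 * 2 ^ m - 1)%N.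
Proof.
rewrite /tt_circuit nparams_cat -/(tt_layers m m) nparams_tt_rot_layer /=.
rewrite divnn expn_gt0 /=.
by have := nparams_tt_layers m m (leqnn m); rewrite subSnn expn1 expnS; lia.
Qed.

Lemma nrot1_tt_circuit m : nrot1 (tt_circuit m) = (1 + m)%N.
Proof.
rewrite /tt_circuit nrot1_cat -/(tt_layers m m) nrot1_tt_layers //.
by rewrite nrot1_tt_rot_layer // addnC.
Qed.

(** Having at least two parameters forces the first and the last rotation to be distinct gates. *)
Lemma ends_split s u v : (1 < nparams s)%N -> s = RotG 1 :: u ->
  s = rcons v (RotG 1) -> exists s', s = rcons (RotG 1 :: s') (RotG 1).
Proof.
case: v => [|g v] s2 su sv; first by rewrite sv in s2.
by exists v; rewrite sv; move: sv; rewrite su => -[<-].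
Qed.

Lemma tt_circuit_ends m : (0 < m)%N ->
  exists s, tt_circuit m = rcons (RotG 1 :: s) (RotG 1).
Proof.
case: m => // m _.
have lt2 : (1 < nparams (tt_circuit m.+1))%N.
  rewrite nparams_tt_circuit expnS.
  by have : (0 < 2 ^ m)%N := expn_gt0 2 m; lia.
have last1 : tt_circuit m.+1 = rcons (tt_layers m.+1 m.+1) (RotG 1).
  rewrite /tt_circuit -cats1; congr (_ ++ _).
  by rewrite /tt_rot_layer /= divnn expn_gt0.
have [u fst1] : exists u, tt_circuit m.+1 = RotG 1 :: u.
  rewrite /tt_circuit /= {1}/tt_rot_layer /= expn0 divn1.
  have : (0 < 2 ^ m.+1)%N by rewrite expn_gt0.
  by case: (2 ^ m.+1)%N => // k _ /=; eexists.
exact: ends_split fst1 last1.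
Qed.

(** * The step-controlled circuit *)

Lemma rot_qubits_blocks (a b q : nat -> nat) r :
  rot_qubits (flatten [seq [:: CXG (a l) (b l); RotG (q l)] | l <- r]) = map q r.
Proof. by elim: r => //= l r ->. Qed.

Lemma all_flatten (T : Type) (a : pred T) ss : all a (flatten ss) = all (all a) ss.
Proof. by elim: ss => //= s ss IHs; rewrite all_cat IHs. Qed.

Lemma valid_sc_circuit n nc : (1 <= nc <= n - 1)%N ->
  all (valid_gate n) (sc_circuit n nc).
Proof.
move=> ncn; rewrite /sc_circuit all_cat; apply/andP; split.
  by rewrite all_map; apply/allP => q; rewrite mem_iota /= => qn; lia.
rewrite all_flatten all_map; apply/allP => l; rewrite mem_iota => ln.
rewrite /= andbT; apply/andP; split.
  by case: ifP => le_l; apply/and3P; split; lia.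
by case: ifP => le_l; lia.
Qed.

Lemma nparams_sc_circuit n nc : (0 < n)%N -> nparams (sc_circuit n nc) = (2 * n - 1)%N.
Proof.
move=> n0; rewrite /sc_circuit nparams_cat -!size_rot_qubits rot_qubits_blocks.
by rewrite (rot_qubits_map id) !size_map !size_iota; lia.
Qed.

Lemma nrot1_sc_circuit n nc : (1 <= nc <= n - 1)%N ->
  nrot1 (sc_circuit n nc) = (1 + nc)%N.
Proof.
move=> ncn; rewrite /sc_circuit nrot1_cat /nrot1 rot_qubits_blocks.
rewrite (rot_qubits_map id) map_id; congr (_ + _)%N.
  by rewrite count_uniq_mem ?iota_uniq // mem_iota; lia.
rewrite count_map.
(* Among the blocks after the first layer, the first [n - 1 - nc] rotate qubit [n - l], which
   exceeds 1, and the last [nc] rotate qubit 1. *)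
have -> : (n - 1 = (n - 1 - nc) + nc)%N by lia.
rewrite iotaD count_cat (eq_in_count (a2 := pred0)) ?count_pred0.
  rewrite (eq_in_count (a2 := predT)) ?count_predT ?size_iota // => l.
  by rewrite mem_iota /= => ln; case: ifP => //; lia.
by move=> l; rewrite mem_iota /= => ln; case: ifP; lia.
Qed.

Lemma sc_circuit_ends n nc : (1 <= nc <= n - 1)%N ->
  exists s, sc_circuit n nc = rcons (RotG 1 :: s) (RotG 1).
Proof.
move=> ncn.
have lt2 : (1 < nparams (sc_circuit n nc))%N by rewrite nparams_sc_circuit; lia.
have [u fst1] : exists u, sc_circuit n nc = RotG 1 :: u.
  rewrite /sc_circuit; have -> : n = n.-1.+1 by lia.
  by eexists.
have [v last1] : exists v, sc_circuit n nc = rcons v (RotG 1).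
  rewrite /sc_circuit; have [k kE] : exists k, (n - 1 = k.+1)%N by exists (n - 2)%N; lia.
  rewrite kE iota_rcons map_rcons flatten_rcons.
  (* The last block has [l = n - 1], and [nc >= 1] puts it in the branch on qubit 1. *)
  have -> : ((1 + k).+1 <= n - nc)%N = false by lia.
  by eexists; rewrite -cats1 -[[:: CXG _ _; _]]/([:: _] ++ [:: _]) !catA.
exact: ends_split fst1 last1.
Qed.

Theorem theorem2 (R : realType) (n : nat) (rho : 'M[R[i]]_(2 ^ n)) :
  (2 <= n)%N -> density_matrix R rho ->
  (* (i) tree tensor, n = 2^m, log2 n = m *)
  (forall m : nat, n = (2 ^ m)%N ->
     let s := tt_circuit m in
     let f := objective R n s rho in
     (1 + m%:R) / (2 * n%:R) * alpha R rho <= expect R (nparams s) (grad_sqnorm R (nparams s) f)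
     /\ expect R (nparams s) (grad_sqnorm R (nparams s) f) <= (2 * n - 1)%:R) /\
  (* (ii) step controlled *)
  (forall nc : nat, (1 <= nc <= n - 1)%N ->
     let s := sc_circuit n nc in
     let f := objective R n s rho in
     (1 + nc%:R) / 2 ^+ (1 + nc) * alpha R rho <= expect R (nparams s) (grad_sqnorm R (nparams s) f)
     /\ expect R (nparams s) (grad_sqnorm R (nparams s) f) <= (2 * n - 1)%:R).
Proof.
move=> n2 drho; have n_gt0 : (0 < n)%N by exact: ltnW.
split=> [m nE s f|nc ncn s f].
  subst n; have m_gt0 : (0 < m)%N by case: m n2 {rho drho n_gt0 s f}.
  have vs := valid_tt_circuit m; split; last first.
    by rewrite -(nparams_tt_circuit m); exact: expect_grad_le.
  have [u uE] := tt_circuit_ends m m_gt0.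
  have := expect_grad_ge R _ rho n_gt0 u; rewrite -uE => /(_ vs).
  (* With K = 1 + m, the denominator 2^K is 2 n. *)
  by rewrite nrot1_tt_circuit exprS natrD natrX.
have vs := valid_sc_circuit n nc ncn; split; last first.
  by rewrite -(nparams_sc_circuit n nc n_gt0); exact: expect_grad_le.
have [u uE] := sc_circuit_ends n nc ncn.
have := expect_grad_ge R _ rho n_gt0 u; rewrite -uE => /(_ vs).
by rewrite nrot1_sc_circuit // natrD.
Qed.
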